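(* Let $I$ be a closed bounded real interval, let $J\subseteq\mathbb{R}$ with $[0,1]\subseteq J$, let $h:J\to\mathbb{R}$ be a nonnegative function, and let $f,g:I\to(0,\infty)$ be $h$-logarithmically convex functions on $I$. Suppose that $h$ is symmetric about $\frac12$, i.e. $h(t)=h(1-t)$ for $t\in[0,1]$. Then for all $a,b\in I$ with $a<b$, $$\frac{1}{b-a}\int_a^b (fg)(x)\,dx\le \int_0^1 \left[(fg)(a)\,(fg)(b)\right]^{h(t)}dt,$$ where $(fg)(x)=f(x)g(x)$.
   Context: A positive function $f$ on a real interval $I$ is called $h$-logarithmically convex ($h$-$\log$-convex) if for all $x,y\in I$ and $t\in[0,1]$, $f(tx+(1-t)y)\le [f(x)]^{h(t)}[f(y)]^{h(1-t)}$, where $h:J\to\mathbb{R}$ is a nonnegative function on $J\subseteq\mathbb{R}$. *)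

(* Defs.v *)
From HB Require Import structures.
From mathcomp Require Import all_boot all_order all_algebra.
From mathcomp Require Import all_classical all_reals all_analysis.
Set Implicit Arguments.
Unset Strict Implicit.
Unset Printing Implicit Defensive.
Import Order.TTheory GRing.Theory Num.Theory.
Import numFieldNormedType.Exports.
Local Open Scope classical_set_scope.
Local Open Scope ring_scope.

(* Partial functions are represented by total ones: [f] is only inspected on
   [I], and [h] only on [0, 1]. The nonnegativity of [h] on its domain is not
   part of this predicate. For a positive base, [a `^ x] is [expR (x * ln a)]. *)
Definition h_log_convex (R : realType) (h : R -> R) (I : interval R)
    (f : R -> R) : Prop :=
  (forall x, x \in I -> 0 < f x) /\
  (forall x y t, x \in I -> y \in I -> t \in `[0, 1] ->
     f (t * x + (1 - t) * y) <= f x `^ h t * f y `^ h (1 - t)).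

(* Main.v *)
Require Import Defs.
From HB Require Import structures.
From mathcomp Require Import all_boot all_order all_algebra.
From mathcomp Require Import all_classical all_reals all_analysis.
From mathcomp Require Import measurable_realfun ring lra.
Set Implicit Arguments.
Unset Strict Implicit.
Unset Printing Implicit Defensive.
Import Order.TTheory GRing.Theory Num.Theory.
Import numFieldNormedType.Exports.
Import HBNNSimple.
Local Open Scope classical_set_scope.
Local Open Scope ring_scope.

(* The substitution x = a + t(b - a) turns the mean of fg over [a, b] into the
   integral over [0, 1] of fg(tb + (1 - t)a), which h-log-convexity and the symmetry
   of h bound pointwise by ((fg)(a)(fg)(b))^h(t). Neither f, g nor h is assumed
   measurable, so the integrals are lower integrals, and both monotonicity and the
   substitution are proved for arbitrary nonnegative integrands. *)

(** Each integral is a supremum over the simple functions below the integrand, and those below [F]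
    are also below [G]. *)
Lemma ge0_le_integral_nonmeasurable d (T : measurableType d) (R : realType)
    (mu : {measure set T -> \bar R}) (D : set T) (F G : T -> \bar R) :
  (forall x, D x -> 0 <= F x)%E -> (forall x, D x -> F x <= G x)%E ->
  (\int[mu]_(x in D) F x <= \int[mu]_(x in D) G x)%E.
Proof.
move=> F0 FG.
have G0 x : D x -> (0 <= G x)%E by move=> Dx; exact: le_trans (F0 x Dx) (FG x Dx).
rewrite !ge0_integralE//; apply: ereal_sup_le => _ [s /= sF <-]; exists s => //= x.
apply: le_trans (sF x) _; rewrite /patch; case: ifPn => // /set_mem.
exact: FG.
Qed.

Section affine_substitution.
Variables (R : realType) (k c : R).
Hypothesis k0 : 0 < k.

Let phi : measurableTypeR R -> measurableTypeR R := fun x => k * x + c.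

Let mphi : measurable_fun setT phi.
Proof. by apply: measurable_funD => //; exact: measurable_funM. Qed.

Let nu : {measure set (measurableTypeR R) -> \bar R}.
Proof.
unshelve refine (mscale (NngNum (ltW k0)) (pushforward lebesgue_measure phi)).
exact: mphi.
Defined.

(** Lebesgue measure is determined by its values on the intervals []u, v]]. Preimages under [phi]
    divide lengths by [k], which the factor [k] in [nu] undoes. *)
Let lebesgue_measure_affine (A : set R) :
  measurable A -> lebesgue_measure A = nu A.
Proof.
apply: lebesgue_measure_unique => _ [[u v]] _ <-.
rewrite /nu /= /mscale /= -[pushforward _ _ _]/(lebesgue_measure (phi @^-1` _)).
have -> : phi @^-1` `]u, v] = `](u - c) / k, (v - c) / k]%classic.
  apply/seteqP; split => x;
    by rewrite /phi /= !in_itv/= ltr_pdivrMr// ler_pdivlMr// ltrBlDr lerBrDr mulrC.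
rewrite !lebesgue_measure_itv/= !lte_fin ltr_pM2r ?invr_gt0// ltrD2r.
case: ifPn => _; last by rewrite mule0.
by rewrite -!EFinB -EFinM; congr EFin; field; rewrite gt_eqF.
Qed.

(* [s] ranges over the simple functions below [F], for which the substitution is
   the transfer theorem for measurable functions. *)
Lemma le_integral_affine (F : R -> \bar R) : (forall x, 0 <= F x)%E ->
  (\int[lebesgue_measure]_x F x <=
   k%:E * \int[lebesgue_measure]_x F (k * x + c)%R)%E.
Proof.
move=> F0; rewrite ge0_integralTE//; apply: ge_ereal_sup => _ [s /= sF <-].
have s0 x : (0 <= (s x)%:E)%E by rewrite lee_fin.
rewrite -integralT_nnsfun (eq_measure_integral nu); last first.
  by move=> A mA _; exact: lebesgue_measure_affine.
have ms : measurable_fun setT (EFin \o s) by exact/measurable_EFinP.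
rewrite /nu ge0_integral_mscale//= ge0_integral_pushforward//.
rewrite lee_pmul2l// preimage_setT.
(* The integrand on the right, [F] composed with [phi], may be nonmeasurable. *)
by apply: ge0_le_integral_nonmeasurable => x _ //=; exact: sF.
Qed.

End affine_substitution.

Theorem theorem2 (R : realType) (c d : R) (J : set R) (h f g : R -> R)
    (J01 : `[0, 1]%classic `<=` J)
    (h_ge0 : forall t, J t -> 0 <= h t)
    (f_cvx : h_log_convex h `[c, d] f)
    (g_cvx : h_log_convex h `[c, d] g)
    (h_sym : forall t, t \in `[0, 1] -> h t = h (1 - t))
    (a b : R) (aI : a \in `[c, d]) (bI : b \in `[c, d]) (ab : a < b) :
  (((b - a)^-1)%:E * \int[lebesgue_measure]_(x in `[a, b]) ((f \* g) x)%:E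
   <= \int[lebesgue_measure]_(t in `[0%R, 1%R])
        (((f \* g) a * (f \* g) b) `^ h t)%:E)%E.
Proof.
have [f0 fc] := f_cvx; have [g0 gc] := g_cvx.
have ba0 : 0 < b - a by rewrite subr_gt0.
have sub_cd (t : R) : t \in `[0, 1] -> (b - a) * t + a \in `[c, d].
  move: aI bI; rewrite !in_itv/= => /andP[ca ad] /andP[cb bd] /andP[t0 t1].
  by apply/andP; split; nra.
have fg_le (t : R) : t \in `[0, 1] ->
    (f \* g) ((b - a) * t + a) <= ((f \* g) a * (f \* g) b) `^ h t.
  move=> t01 /=.
  have phiE : t * b + (1 - t) * a = (b - a) * t + a by ring.
  (* Symmetry gives the endpoint values the common exponent [h t], so that the bounds for [f] and
     [g] multiply to a single power. *)
  have := fc _ _ _ bI aI t01; rewrite -h_sym// phiE [leRHS]mulrC => f_le.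
  have := gc _ _ _ bI aI t01; rewrite -h_sym// phiE [leRHS]mulrC => g_le.
  rewrite !powRM ?mulr_ge0 ?(ltW (f0 _ _)) ?(ltW (g0 _ _))// mulrACA.
  by apply: ler_pM => //; apply/ltW; [apply: f0|apply: g0]; exact: sub_cd.
(* The substitution is stated on the whole line, so the integrand is extended by zero outside
   [[a, b]]. *)
rewrite muleC lee_pdivrMr// integral_mkcond.
apply: le_trans (le_integral_affine a ba0 _) _.
  move=> x; rewrite /patch; case: ifPn => // /set_mem/= xab.
  have xcd : x \in `[c, d].
    move: xab aI bI; rewrite !in_itv/= => /andP[ax xb] /andP[ca _] /andP[_ bd].
    by rewrite (le_trans ca ax) (le_trans xb bd).
  by rewrite lee_fin mulr_ge0// ltW ?f0 ?g0.
rewrite muleC lee_pmul2r// [leRHS]integral_mkcond.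
(* The two extensions by zero vanish for the same [t], which leaves only [t] in [[0, 1]] to
   compare. *)
have phi_ab t : ((b - a) * t + a \in `[a, b]%classic) = (t \in `[0, 1]%classic).
  apply/idP/idP; rewrite !inE /= !in_itv/= => /andP[t0 t1]; apply/andP; split; nra.
apply: ge0_le_integral_nonmeasurable => t _; rewrite /patch phi_ab; case: ifPn => //.
  move=> /set_mem/= t01; rewrite lee_fin mulr_ge0// ltW ?f0 ?g0//; exact: sub_cd.
move=> /set_mem/= t01; rewrite lee_fin; exact: fg_le.
Qed.
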